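(* Let $\Omega$ be an infinite set. Then there are $2^{2^{|\Omega|}}$ pairwise non-conjugate maximal subsemigroups of $\Omega^\Omega$.
   Context: $\Omega^\Omega$ is the semigroup of all mappings from $\Omega$ to itself (written on the right and composed from left to right). A subsemigroup $T$ of a semigroup $S$ is a maximal subsemigroup if $T\neq S$ and the subsemigroup generated by $T$ and $s$ equals $S$ for all $s\in S\setminus T$. Two subsemigroups $M,N$ of $\Omega^\Omega$ are conjugate if $N=a^{-1}Ma$ for some $a$ in the symmetric group $\operatorname{Sym}(\Omega)$. *)

(* Defs.v *)
From HB Require Import structures.
From mathcomp Require Import all_boot.
From mathcomp Require Import boolp classical_sets functions cardinality.

Set Implicit Arguments.
Unset Strict Implicit.
Unset Printing Implicit Defensive.

Local Open Scope classical_set_scope.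
Local Open Scope group_scope.

Section Subsemigroups.
Variable S : semigroupType.
Implicit Types T G : set S.

(* The empty set is allowed; in the full transformation semigroup of an
   infinite set it is not maximal, so this choice has no effect there. *)
Definition subsemigroup T : Prop :=
  forall x y : S, T x -> T y -> T (x * y).

Definition gen_subsemigroup G : set S := smallest subsemigroup G.

Definition maximal_subsemigroup T : Prop :=
  [/\ subsemigroup T, T <> [set: S] &
      forall s : S, ~ T s -> gen_subsemigroup (T `|` [set s]) = [set: S]].

End Subsemigroups.

(* Mappings act on the right: [f * g] is "first [f], then [g]". *)
Definition full_transf (Omega : Type) : Type := Omega -> Omega.

Section FullTransf.
Variable Omega : Type.

Definition transf_mul (f g : full_transf Omega) : full_transf Omega :=
  fun x => g (f x).

Lemma transf_mulA : associative transf_mul.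
Proof. by []. Qed.

HB.instance Definition _ := gen_eqMixin (full_transf Omega).
HB.instance Definition _ := gen_choiceMixin (full_transf Omega).
HB.instance Definition _ :=
  isSemigroup.Build (full_transf Omega) transf_mulA.

(* [b] is the inverse of the permutation [a] of [Omega]. *)
Definition conjugate (M N : set (full_transf Omega)) : Prop :=
  exists a b : full_transf Omega,
    [/\ cancel a b, cancel b a & N = [set b * m * a | m in M]].

End FullTransf.

(* Main.v *)
Require Import Defs.
From mathcomp Require Import all_boot.
From mathcomp Require Import boolp classical_sets functions cardinality.

(** There is a family of [2^|Omega|] subsets [A X] of [Omega], for [X] a subset
of [Omega], all of whose finite Boolean combinations have size [|Omega|]
([independent_family]).  Each [s : set (set Omega)] selects [A X] or its
complement for every [X], hence a filter, and the maps that fix some member of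
this filter pointwise form a subsemigroup [fixator A s].  Two facts about maps
are used.

- Over [fixator A s] the full transformation semigroup is generated by two
  maps: if [u] injects [Omega] into the complement of a member of the filter
  and [w] is a left inverse of [u], then every map is [u * h * w] for some [h]
  that fixes this member.  Therefore Zorn's lemma gives a maximal subsemigroup
  [M s] containing [fixator A s] ([fixator_maximal]).

- If [s] and [t] differ, then some [B] in one filter has its complement in the
  other, and every map is a product of three maps, each of which fixes [B] or
  its complement pointwise.  Therefore no proper subsemigroup contains both
  fixators ([fixators_generate]), and [M] is injective.

This gives [2^(2^|Omega|)] maximal subsemigroups.  A conjugacy class has at
most [2^|Omega|] members, as it is indexed by permutations, so cardinal
arithmetic leaves [2^(2^|Omega|)] classes ([inequivalent_family]).  The
cardinal arithmetic, and the construction of the independent family, rest on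
the comparability of cardinals ([embeds_total]) and on [kappa * kappa = kappa]
for infinite [kappa] ([embeds_square]), both obtained from Zorn's lemma. *)

Local Open Scope classical_set_scope.
Local Open Scope card_scope.

Set Implicit Arguments.
Unset Strict Implicit.

(** * Injections between types and cardinal arithmetic *)

Definition embeds (A B : Type) : Prop := exists f : A -> B, injective f.

Lemma embeds_trans A B C : embeds A B -> embeds B C -> embeds A C.
Proof. by move=> [f fI] [g gI]; exists (g \o f); exact: inj_comp. Qed.

Lemma embeds_refl A : embeds A A. Proof. by exists id. Qed.

Lemma embeds_set1 K : embeds K (set K).
Proof. by exists set1 => x y xy; have : [set y] x by rewrite -xy. Qed.

Lemma embeds_prod A B C D :
  embeds A C -> embeds B D -> embeds (A * B) (C * D).
Proof.
move=> [f fI] [g gI]; exists (fun p => (f p.1, g p.2)).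
by move=> [a b] [a' b'] [/fI-> /gI->].
Qed.

Lemma embeds_set A B : embeds A B -> embeds (set A) (set B).
Proof.
move=> [f fI]; exists (fun X => f @` X) => X Y XY; apply/seteqP; split=> x xX.
  by have [y Yy /fI<-] : (f @` Y) (f x) by rewrite -XY; exists x.
by have [y Xy /fI<-] : (f @` X) (f x) by rewrite XY; exists x.
Qed.

Lemma left_inverse_exists A B (a0 : A) (f : A -> B) :
  injective f -> exists g : B -> A, cancel f g.
Proof.
move=> fI.
have /choice[g gP] : forall y, exists x, (exists x', f x' = y) -> f x = y.
  move=> y; have [[x xy]|n] := pselect (exists x, f x = y); first by exists x.
  by exists a0.
by exists g => x; apply: fI; apply: gP; exists x.
Qed.

(** What lets a condition on finitely many points of a graph pass to the union
of a chain of graphs, as needed to apply Zorn's lemma. *)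
Lemma chain_common T (F : set (set T)) (p q : T) :
  total_on F subset -> (\bigcup_(X in F) X) p -> (\bigcup_(X in F) X) q ->
  exists2 X, F X & X p /\ X q.
Proof.
move=> Ftot [X FX Xp] [Y FY Yq].
have [XY|YX] := Ftot X Y FX FY; [exists Y|exists X] => //; split=> //.
  exact: XY.
exact: YX.
Qed.

(** A maximal partial injection from [A] to [B], given by its graph, is total
or onto: otherwise an unmatched point on each side could be added to it. *)
Lemma embeds_total A B : embeds A B \/ embeds B A.
Proof.
pose P (R : set (A * B)) :=
  forall p q, R p -> R q -> p.1 = q.1 <-> p.2 = q.2.
have [|R [PR Rmax]] := @Zorn_bigcup _ P.
  move=> F FP Ftot p q Up Uq.
  by have [X FX [Xp Xq]] := chain_common Ftot Up Uq; exact: (FP X).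
have [dR|/existsNP[x xR]] := pselect (forall x, exists y, R (x, y)).
  have [f fR] := choice dR; left; exists f => x y fxy.
  by apply/(PR _ _ (fR x) (fR y)).
have [rR|/existsNP[y yR]] := pselect (forall y, exists x, R (x, y)).
  have [f fR] := choice rR; right; exists f => y y' fyy.
  by apply/(PR _ _ (fR y) (fR y')).
exfalso; apply: (Rmax (R `|` [set (x, y)])).
  split; first by move=> p; left.
  by move=> /(_ (x, y) (or_intror erefl)) Rxy; apply: xR; exists y.
have xyP p : R p -> p.1 <> x /\ p.2 <> y.
  case: p => u v Ruv; split=> /= uv; subst.
    by apply: xR; exists v.
  by apply: yR; exists u.
move=> p q [Rp|->] [Rq|->] //=.
- exact: PR.
- by have [? ?] := xyP _ Rp.
- by have [? ?] := xyP _ Rq; split=> /esym.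
Qed.

Lemma sub_embeds_total T (A B : set T) :
  (exists e : T -> T, (forall x, A x -> B (e x)) /\
     forall x y, A x -> A y -> e x = e y -> x = y) \/
  (exists e : T -> T, (forall x, B x -> A (e x)) /\
     forall x y, B x -> B y -> e x = e y -> x = y).
Proof.
have extend (C D : set T) : embeds {x | C x} {x | D x} ->
    exists e : T -> T, (forall x, C x -> D (e x)) /\
      forall x y, C x -> C y -> e x = e y -> x = y.
  move=> [e eI].
  exists (fun x => if pselect (C x) is left h
                   then sval (e (exist _ x h)) else x).
  split=> [x Cx|x y Cx Cy]; case: pselect => // h.
    exact: (svalP (e (exist _ x h))).
  by case: pselect => // h' /eq_sig_hprop-/(_ (fun _ => @Prop_irrelevance _))/eI[].
by have [/extend|/extend] := embeds_total {x | A x} {x | B x}; [left|right].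
Qed.

Section Hessenberg.
Variables (T : Type) (a b : T).
Hypothesis ab : a <> b.

Definition carrier (G : set (T * T * T)) : set T :=
  [set x | exists y z, G (x, y, z)].

(** [G] is the graph of an injection [carrier G * carrier G -> carrier G].
Graphs, unlike functions, have unions along chains.  When [a <> b], the last
field excludes one-point carriers, on which the pairing cannot encode a bit,
while still admitting the empty graph, which is the union of the empty chain. *)
Record pairing (G : set (T * T * T)) : Prop := Pairing {
  pairing_inj x y z x' y' : G (x, y, z) -> G (x', y', z) -> (x, y) = (x', y');
  pairing_fun x y z z' : G (x, y, z) -> G (x, y, z') -> z = z';
  pairing_carrier x y z : G (x, y, z) -> carrier G y /\ carrier G z;
  pairing_total x y : carrier G x -> carrier G y -> exists z, G (x, y, z);
  pairing_base x : carrier G x -> carrier G a /\ carrier G b }.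

Lemma bigcup_pairing (F : set (set (T * T * T))) :
  F `<=` pairing -> total_on F subset -> pairing (\bigcup_(G in F) G).
Proof.
move=> FP Ftot; set U := \bigcup_(G in F) G.
have fU G x : F G -> carrier G x -> carrier U x.
  by move=> FG [y [z Gxyz]]; exists y, z, G.
split.
- move=> x y z x' y' Up Uq.
  have [G FG [Gp Gq]] := chain_common Ftot Up Uq.
  exact: (pairing_inj (FP G FG) Gp Gq).
- move=> x y z z' Up Uq.
  have [G FG [Gp Gq]] := chain_common Ftot Up Uq.
  exact: (pairing_fun (FP G FG) Gp Gq).
- move=> x y z [G FG Gp]; have [fy fz] := pairing_carrier (FP _ FG) Gp.
  by split; exact: fU FG _.
- move=> x y [x' [x'' Up]] [y' [y'' Uq]].
  have [G FG [Gp Gq]] := chain_common Ftot Up Uq.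
  have [||z Gz] := pairing_total (FP _ FG) (x := x) (y := y).
  - by exists x', x''.
  - by exists y', y''.
  by exists z, G.
- move=> x [y [z [G FG Gp]]].
  have [|fa fb] := pairing_base (FP _ FG) (x := x); first by exists y, z.
  by split; exact: fU FG _.
Qed.

Lemma pairing_function (G : set (T * T * T)) : pairing G ->
  exists f : T -> T -> T, [/\
    forall x y, carrier G x -> carrier G y -> G (x, y, f x y),
    forall x y, carrier G x -> carrier G y -> carrier G (f x y) &
    forall x y x' y',
      carrier G x -> carrier G y -> carrier G x' -> carrier G y' ->
      f x y = f x' y' -> x = x' /\ y = y'].
Proof.
move=> PG.
have /choice[f fP] : forall p : T * T, exists z,
    carrier G p.1 -> carrier G p.2 -> G (p.1, p.2, z).
  move=> [x y] /=.
  have [[dx dy]|n] := pselect (carrier G x /\ carrier G y); last first.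
    by exists a => dx dy; case: n.
  by have [z Gz] := pairing_total PG dx dy; exists z.
have fG x y : carrier G x -> carrier G y -> G (x, y, f (x, y)) by exact: fP (x, y).
exists (fun x y => f (x, y)); split=> // [x y dx dy|x y x' y' dx dy dx' dy' E].
  by have [] := pairing_carrier PG (fG x y dx dy).
have := fG x' y' dx' dy'; rewrite -E => G'.
by have [-> ->] := pairing_inj PG (fG x y dx dy) G'.
Qed.

(** A disjoint copy [e D] of the carrier [D] can be absorbed.  A point of the
doubled carrier is a bit [i] and a point of [D] (this is [k i x]).  A pair of
points with bits [i], [j] is sent into [D] by the old pairing when both bits
are [false], and otherwise into the copy, after the old pairing has been used
to encode the two bits, as [a] or [b], along with the two points. *)
Lemma pairing_extend (G : set (T * T * T)) (e : T -> T) :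
  pairing G -> carrier G !=set0 ->
  (forall x, carrier G x -> ~ carrier G (e x)) ->
  (forall x y, carrier G x -> carrier G y -> e x = e y -> x = y) ->
  exists2 H, pairing H & G `<` H.
Proof.
move=> PG [d0 /(pairing_base PG)[fa fb]] eD eI.
set D := carrier G in eD eI fa fb *.
have [f [fG fD fI]] := pairing_function PG; rewrite -/D in fG fD fI.
pose k (i : bool) x := if i then e x else x.
have kI i j x y : D x -> D y -> k i x = k j y -> i = j /\ x = y.
  case: i; case: j => //= dx dy E.
  - by split=> //; exact: eI.
  - by case: (eD x dx); rewrite E.
  - by case: (eD y dy); rewrite -E.
pose t (i : bool) := if i then a else b.
have tD i : D (t i) by case: i.
have tI : injective t by move=> [] [] //= E; case: ab; rewrite E.
pose c i j x y := if i || j then f (t i) (f (t j) (f x y)) else f x y.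
have cD i j x y : D x -> D y -> D (c i j x y).
  move=> dx dy; rewrite /c; case: ifP => _; last exact: fD.
  exact: (fD _ _ (tD i) (fD _ _ (tD j) (fD _ _ dx dy))).
pose H : set (T * T * T) := [set p | exists i j x y, [/\ D x, D y &
  p = (k i x, k j y, k (i || j) (c i j x y))]].
have HP i j x y : D x -> D y -> H (k i x, k j y, k (i || j) (c i j x y)).
  by move=> dx dy; exists i, j, x, y.
have carrierH x : carrier H x <-> exists i y, D y /\ x = k i y.
  split=> [[y [z [i [j [x' [y' [dx dy [-> _ _]]]]]]]]|[i [y [dy ->]]]].
    by exists i, x'.
  by exists (k false a), (k (i || false) (c i false y a)); exact: HP.
have GH : G `<=` H.
  move=> [[x y] z] Gp.
  have dx : D x by exists y, z.
  have [dy dz] := pairing_carrier PG Gp.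
  exists false, false, x, y; split=> //; congr (_, _, _).
  exact: (pairing_fun PG Gp (fG _ _ dx dy)).
exists H; last first.
  split=> // HG; have [u [v Hu]] : carrier H (e a) by apply/carrierH; exists true, a.
  by apply: (eD a fa); exists u, v; exact: HG.
split.
- move=> x y z x' y' [i [j [u [v [du dv [-> -> ->]]]]]].
  move=> [i' [j' [u' [v' [du' dv' [-> -> E]]]]]].
  have [E1] := kI _ _ _ _ (cD i j u v du dv) (cD i' j' u' v' du' dv') E.
  rewrite /c -E1; case: ifP => ij.
    move/(fI _ _ _ _ (tD _) (fD _ _ (tD _) (fD _ _ du dv))
                     (tD _) (fD _ _ (tD _) (fD _ _ du' dv'))).
    move=> [/tI ei /(fI _ _ _ _ (tD _) (fD _ _ du dv) (tD _) (fD _ _ du' dv'))].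
    by move=> [/tI ej /(fI _ _ _ _ du dv du' dv')[eu ev]]; rewrite ei ej eu ev.
  move=> /(fI _ _ _ _ du dv du' dv')[eu ev]; rewrite eu ev.
  (* Equal values have equal bits [i || j], here [false], so all four bits
     are [false]. *)
  by move: ij E1; clear; case: i; case: j; case: i'; case: j'.
- move=> x y z z' [i [j [u [v [du dv [-> -> ->]]]]]].
  move=> [i' [j' [u' [v' [du' dv' [E1 E2 ->]]]]]].
  by have [-> ->] := kI _ _ _ _ du du' E1; have [-> ->] := kI _ _ _ _ dv dv' E2.
- move=> x y z [i [j [u [v [du dv [_ -> ->]]]]]]; split; apply/carrierH.
    by exists j, v.
  by exists (i || j), (c i j u v); split=> //; exact: cD.
- move=> x y /carrierH[i [u [du ->]]] /carrierH[j [v [dv ->]]].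
  by exists (k (i || j) (c i j u v)); exact: HP.
- by move=> x _; split; apply/carrierH; exists false; [exists a|exists b].
Qed.

End Hessenberg.

Lemma nat_pairing T (i : nat -> T) : injective i ->
  exists2 G, pairing (i 0) (i 1) G & G !=set0.
Proof.
move=> iI.
pose G : set (T * T * T) :=
  [set p | exists m n, p = (i m, i n, i (pickle (m, n)))].
have fG x : carrier G x <-> exists m, x = i m.
  split=> [[y [z [m [n [-> _ _]]]]]|[m ->]]; first by exists m.
  by exists (i 0), (i (pickle (m, 0))), m, 0.
exists G; last by exists (i 0, i 0, i (pickle (0, 0))), 0, 0.
split.
- move=> x y z x' y' [m [n [-> -> ->]]] [m' [n' [-> -> /iI]]].
  by move/(pcan_inj pickleK) => [-> ->].
- by move=> x y z z' [m [n [-> -> ->]]] [m' [n' [/iI-> /iI-> ->]]].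
- by move=> x y z [m [n [_ -> ->]]]; split; apply/fG; eexists.
- move=> x y /fG[m ->] /fG[n ->]; exists (i (pickle (m, n))); by exists m, n.
- by move=> x _; split; apply/fG; eexists.
Qed.

(** Hessenberg's theorem.  Let [D] be the carrier of a maximal pairing.  Its
complement contains no copy of [D], by [pairing_extend], so by comparability
the complement embeds in [D].  Hence [T] embeds in two copies of [D], thus in
[D * D], thus in [D], and the pairing of [D] induces one of [T]. *)
Theorem embeds_square T : embeds nat T -> embeds (T * T) T.
Proof.
move=> [i iI]; pose a := i 0; pose b := i 1.
have ab : a <> b by move/iI.
have [|G [PG Gmax]] := @Zorn_bigcup _ (pairing a b).
  exact: bigcup_pairing.
have [d0 fd0] : carrier G !=set0.
  apply/set0P/negP => /eqP G0.
  have [H PH [p Hp]] := nat_pairing iI.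
  apply: (Gmax H) => //; split=> [[[x y] z] Gp|HG].
    have : carrier G x by exists y, z.
    by rewrite G0.
  case: p Hp => [[x y] z] /HG Gp.
  have : carrier G x by exists y, z.
  by rewrite G0.
have [fa fb] := pairing_base PG fd0.
have [[e [eD eI]]|[e [eD eI]]] :=
    sub_embeds_total (carrier G) (~` carrier G).
  have [H PH] := pairing_extend ab PG (ex_intro _ d0 fd0) eD eI.
  by move/Gmax.
have [f [_ fD fI]] := pairing_function PG.
(* [h] tags a point of [D] with [a], and a point outside [D] with [b]. *)
have [h [hD hI]] : exists h : T -> T, (forall x, carrier G (h x)) /\ injective h.
  exists (fun x => if pselect (carrier G x) then f a x else f b (e x)).
  split=> [x|x y]; first by case: pselect => ? /=; apply: fD => //; exact: eD.
  case: pselect => dx; case: pselect => dy /= /fI.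
  - by case.
  - by case=> //; exact: eD.
  - by case=> //; [exact: eD|move/esym].
  - by case=> //; [exact: eD|exact: eD|move=> _ /eI; exact].
exists (fun p => f (h p.1) (h p.2)) => -[x y] [x' y'] /= /fI.
by case=> // /hI-> /hI->.
Qed.

(** Iterating a pairing of [T] encodes the sequences of each fixed length; the
length has to be stored as well. *)
Lemma embeds_seq T : embeds nat T -> embeds (seq T) T.
Proof.
move=> natT; have [p pI] := embeds_square natT; have [i iI] := natT.
pose code := foldr (fun x y => p (x, y)) (i 0).
apply: embeds_trans (embeds_trans (embeds_prod natT (ex_intro _ id (@inj_id T)))
  (embeds_square natT)).
exists (fun s => (size s, code s)).
elim=> [|x s IH] [|y t] //= [st /pI[-> cst]].
by rewrite (IH t) // st cst.
Qed.

Lemma Cantor K : ~ embeds (set K) K.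
Proof.
move=> [f fI].
pose D := [set x | exists2 X, x = f X & ~ X x].
have nD : ~ D (f D) by move=> DD; have [X /fI <-] := DD; apply.
by apply: (nD); exists D.
Qed.

(** * Large families of inequivalent elements *)

(** The classes have at most [K] elements, so [X] embeds in the product of the
type of class representatives with [K].  Were the representatives to embed in
[K], then so would [X], as [K * K] embeds in [K].  Therefore [K] embeds in the
representatives, and they absorb the factor [K]. *)
Lemma inequivalent_family X K (R : X -> X -> Prop) (Q : K -> X -> X -> Prop) :
  embeds nat K -> ~ embeds X K ->
  (forall x, R x x) -> (forall x y, R x y -> R y x) ->
  (forall x y z, R x y -> R y z -> R x z) ->
  (forall x y, R x y -> exists c, Q c x y) ->
  (forall c x y y', Q c x y -> Q c x y' -> y = y') ->
  exists2 g : X -> X, injective g & forall x y, R (g x) (g y) -> x = y.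
Proof.
move=> Kinf XK Rxx Rsym Rtr RQ Qfun.
have [[x0 _]|noX] := pselect (exists x : X, True); last first.
  by exists id => // x; case: noX; exists x.
have /choice[rep repP] : forall C : set X, exists y, C !=set0 -> C y.
  move=> C; have [[y Cy]|nC] := pselect (C !=set0); first by exists y.
  by exists x0.
pose r x := rep (R x).
have Rr x : R x (r x) by apply: repP; exists x.
have rE x y : R x y -> r x = r y.
  move=> Rxy; congr rep; apply/seteqP; split=> z; first exact/Rtr/Rsym.
  exact: Rtr.
have /choice[c cP] : forall x, exists c, Q c (r x) x.
  by move=> x; apply/RQ/Rsym.
pose reps := {x | r x = x}.
have rr x : r (r x) = r x by apply/esym/rE.
have XrK : embeds X (reps * K).
  exists (fun x => (exist (fun y => r y = y) (r x) (rr x), c x)) => x y [rxy cxy].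
  by apply: (Qfun (c x) (r x)) => //; rewrite rxy cxy.
have [f fI] : embeds X reps.
  have [rK|Kr] := embeds_total reps K.
    case: XK; apply: embeds_trans XrK _.
    exact: embeds_trans (embeds_prod rK (embeds_refl K)) (embeds_square Kinf).
  apply: embeds_trans XrK _.
  apply: embeds_trans (embeds_prod (embeds_refl reps) Kr) _.
  exact: embeds_square (embeds_trans Kinf Kr).
exists (fun x => sval (f x)) => [x y /eq_sig_hprop E|x y /rE].
  by apply/fI/E => ? ? ?; exact: Prop_irrelevance.
rewrite (svalP (f x)) (svalP (f y)) => /eq_sig_hprop E.
by apply/fI/E => ? ? ?; exact: Prop_irrelevance.
Qed.

(** * Independent families of sets *)

(** The Fichtenholz-Kantorovich-Hausdorff construction.  Up to an embedding
into [T], points are triples of a finite sequence [e] of elements of [T], a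
finite set [b] of bit patterns, and a free parameter [w].  Such a point
belongs to [A X] when the trace of [X] on [e] is one of the patterns in [b].
Given finitely many sets, choose [e] separating them and take for [b] the
traces of those that are to contain the point.  The parameter [w] makes every
such Boolean combination as large as [T]. *)
Lemma independent_family T : embeds nat T ->
  exists A : set T -> set T, forall (l : seq (set T)) (s : set (set T)),
    exists2 e : T -> T, injective e &
      forall X w, X \in l -> A X (e w) <-> s X.
Proof.
move=> natT; pose J := (seq T * seq (seq bool) * T)%type.
have [i iI] : embeds J T.
  have TT := embeds_square natT.
  apply: embeds_trans (TT); apply: embeds_prod; last by exists id.
  apply: embeds_trans (TT); apply: embeds_prod; first exact: embeds_seq.
  by apply: embeds_trans natT; exists pickle; exact: pcan_inj pickleK.
have [f0 _] := natT; pose t0 := f0 0.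
have /choice[d dP] : forall p : set T * set T, exists x,
    (p.1 x <-> p.2 x) -> p.1 = p.2.
  move=> [X Y] /=; have [XY|/existsNP[x nx]] := pselect (forall x, X x <-> Y x).
    by exists t0 => _; apply/seteqP; split=> x /XY.
  by exists x.
pose c (e : seq T) (X : set T) := [seq `[< X x >] | x <- e].
pose A X := [set i j | j in [set j : J | c j.1.1 X \in j.1.2]].
have AE X j : A X (i j) <-> c j.1.1 X \in j.1.2.
  by split=> [[j' cj' /iI<-]//|cj]; exists j.
exists A => l s.
pose e := [seq d p | p <- [seq (X, Y) | X <- l, Y <- l]].
pose b := [seq c e X | X <- l & `[< s X >]].
exists (fun w => i (e, b, w)) => [w w' /iI[]//|X w Xl].
rewrite AE /=; split=> [/mapP[Y]|sX]; last first.
  by apply: map_f; rewrite mem_filter Xl andbT; apply/asboolP.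
rewrite mem_filter => /andP[/asboolP sY Yl] cXY.
suff -> : X = Y by [].
apply: (dP (X, Y)) => /=.
have XYd : `[< X (d (X, Y)) >] = `[< Y (d (X, Y)) >].
  move: cXY; rewrite /c -!map_comp => /eq_in_map/(_ (X, Y)); apply.
  by apply/allpairsP; exists (X, Y).
by split=> [/asboolP|/asboolP]; [rewrite XYd|rewrite -XYd] => /asboolP.
Qed.

(** * Existence of maximal subsemigroups *)

(** Zorn's lemma, as for maximal subgroups of a group that is finitely
generated over a subgroup: the union of a chain of subsemigroups that do not
contain both [u] and [w] again does not.  Zorn's lemma is applied to the sets
[A] whose union with [B] is such a subsemigroup, so that the union of the
empty chain needs no separate treatment. *)
Lemma maximal_subsemigroup_above (S : semigroupType) (B : set S) (u w : S) :
  subsemigroup B -> ~ (B u /\ B w) ->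
  (forall N, subsemigroup N -> B `<=` N -> N u -> N w -> N = [set: S]) ->
  exists2 M, maximal_subsemigroup M & B `<=` M.
Proof.
move=> Bsub Buw Bgen.
pose P (A : set S) := subsemigroup (A `|` B) /\ ~ ((A `|` B) u /\ (A `|` B) w).
have [F FP Ftot|A [[Asub Auw] Amax]] := @Zorn_bigcup _ P.
  have F2 x y : (\bigcup_(X in F) X `|` B) x -> (\bigcup_(X in F) X `|` B) y ->
      (B x /\ B y) \/ exists2 X, F X & (X `|` B) x /\ (X `|` B) y.
    move=> [Ux|Bx] [Uy|By].
    - have [X FX [Xx Xy]] := chain_common Ftot Ux Uy.
      by right; exists X => //; split; left.
    - by have [X FX Xx] := Ux; right; exists X => //; split; [left|right].
    - by have [X FX Xy] := Uy; right; exists X => //; split; [right|left].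
    - by left.
  split=> [x y Ux Uy|[Uu Uw]].
    have [[Bx By]|[X FX [Xx Xy]]] := F2 x y Ux Uy; first by right; exact: Bsub.
    have [Xsub _] := FP X FX.
    by have [Xxy|Bxy] := Xsub x y Xx Xy; [left; exists X|right].
  have [//|[X FX Xuw]] := F2 u w Uu Uw.
  by have [_] := FP X FX.
exists (A `|` B); last by move=> x Bx; right.
split=> //.
- by move=> AT; apply: Auw; rewrite AT.
- move=> s ns; set N := gen_subsemigroup _.
  have subN : (A `|` B) `|` [set s] `<=` N by exact: sub_smallest.
  have NB : N `|` B = N.
    by apply/seteqP; split=> [x [//|Bx]|x Nx]; [apply: subN; left; right|left].
  have Nsub : subsemigroup N.
    move=> x y Nx Ny C CG; have [Csub _] := CG.
    exact: Csub (Nx C CG) (Ny C CG).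
  have [[Nu Nw]|nuw] := pselect (N u /\ N w).
    by apply: Bgen => // x Bx; apply: subN; left; right.
  exfalso; apply: (Amax N); last by split; rewrite NB.
  split=> [x Ax|NA]; first by apply: subN; left; left.
  by apply: ns; left; apply: NA; apply: subN; right.
Qed.

(** * Pointwise fixators of filters *)

Section Factorization.
Variables (T : Type) (t0 : T).
Implicit Types (B : set T) (f g h : full_transf T).

Lemma transf_mulE f g x : (f * g)%g x = g (f x). Proof. by []. Qed.

Definition override B f g : full_transf T :=
  fun x => if pselect (B x) then f x else g x.

Lemma overrideT B f g x : B x -> override B f g x = f x.
Proof. by rewrite /override; case: pselect. Qed.

Lemma overrideF B f g x : ~ B x -> override B f g x = g x.
Proof. by rewrite /override; case: pselect. Qed.

(** The monoid is generated by two maps over those that fix the complement of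
[B]: the map [h] does on the copy [u T] inside [B] what [g] does on [T]. *)
Lemma transf_factor B (u : full_transf T) :
  injective u -> (forall x, B (u x)) ->
  exists w : full_transf T, forall g, exists2 h : full_transf T,
    (forall x, ~ B x -> h x = x) & g = (u * h * w)%g.
Proof.
move=> uI uB; have [w uw] := left_inverse_exists t0 uI.
exists w => g; exists (override B (fun x => u (g (w x))) id).
  exact: overrideF.
by apply/funext => x; rewrite !transf_mulE overrideT// !uw.
Qed.

(** The first two maps compose to the injection [h] of [T] into [B], since the
first moves only [B] and the second only its complement.  After that, all the
points that matter lie in [B], where the third map is free to undo [h] and
apply [g]. *)
Lemma transf_three_factors B h g :
  injective h -> (forall x, B (h x)) -> exists f1 f2 f3 : full_transf T,
    [/\ forall x, ~ B x -> f1 x = x, forall x, B x -> f2 x = x,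
        forall x, ~ B x -> f3 x = x & g = (f1 * f2 * f3)%g].
Proof.
move=> hI hB; have [k hk] := left_inverse_exists t0 hI.
exists (override B h id), (override B id h), (override B (fun x => g (k x)) id).
split; [exact: overrideF|exact: overrideT|exact: overrideF|].
apply/funext => x; rewrite !transf_mulE.
suff -> : override B id h (override B h id x) = h x by rewrite overrideT// hk.
have [Bx|nBx] := pselect (B x).
  by rewrite (overrideT _ _ Bx) overrideT.
by rewrite (overrideF _ _ nBx) overrideF.
Qed.

End Factorization.

Section Fixators.
Variables (T : Type) (A : set T -> set T).
Hypothesis Tinf : embeds nat T.
Hypothesis Aind : forall (l : seq (set T)) (s : set (set T)),
  exists2 e : T -> T, injective e & forall X w, X \in l -> A X (e w) <-> s X.

Definition cell (s : set (set T)) (l : seq (set T)) : set T :=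
  [set x | forall X, X \in l -> A X x <-> s X].

Lemma opposite_not_cell s X x : (A X x <-> (~` s) X) -> ~ cell s [:: X] x.
Proof.
by move=> AX /(_ X (mem_head _ _)) sX; move: AX; rewrite sX /setC/=; tauto.
Qed.

(** The pointwise stabilizer of the filter generated by the sets [A X] for
[X] in [s] and the complements of [A X] for [X] not in [s]. *)
Definition fixator (s : set (set T)) : set (full_transf T) :=
  [set f | exists l, forall x, cell s l x -> f x = x].

Lemma fixator_subsemigroup s : subsemigroup (fixator s).
Proof.
move=> f g [l fl] [l' gl']; exists (l ++ l') => x xll'.
rewrite transf_mulE.
by rewrite fl ?gl' // => X Xl; apply: xll'; rewrite mem_cat Xl ?orbT.
Qed.

Lemma fixator_proper s : fixator s <> [set: full_transf T].
Proof.
move=> sT; have [i iI] := Tinf.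
pose f : full_transf T := fun x => if pselect (x = i 0) then i 1 else i 0.
have [l fl] : fixator s f by rewrite sT.
have [e _ el] := Aind l s.
have /fl : cell s l (e (i 0)) by move=> X; exact: el.
by rewrite /f; case: pselect => /= [-> /iI//|ne /esym].
Qed.

(** The complement of a basic set of the filter contains a copy of [T], so
[transf_factor] applies. *)
Lemma fixator_maximal s :
  exists2 M, maximal_subsemigroup M & fixator s `<=` M.
Proof.
(* Any index serves as well as [set0]: [u] maps into the half of
   [A set0], [~` A set0] that is not a member of the filter. *)
have [i _] := Tinf; have [u uI us] := Aind [:: set0] (~` s).
have [|w uw] := transf_factor (i 0) (B := ~` cell s [:: set0]) uI.
  by move=> x; apply/opposite_not_cell/us/mem_head.
have gen N : subsemigroup N -> fixator s `<=` N -> N u -> N w ->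
    N = [set: full_transf T].
  move=> Nsub sN Nu Nw; apply/seteqP; split=> // g _.
  have [h hid ->] := uw g; apply: (Nsub) => //; apply: (Nsub) => //.
  by apply: sN; exists [:: set0] => x sx; apply: hid.
apply: maximal_subsemigroup_above (gen); first exact: fixator_subsemigroup.
move=> [su sw]; apply: (@fixator_proper s).
by apply: gen => //; exact: fixator_subsemigroup.
Qed.

(** If [s] and [t] differ at [X], then one filter contains [A X] and the other
its complement, so the two fixators contain every map needed in
[transf_three_factors]. *)
Lemma fixators_generate s t (N : set (full_transf T)) : s <> t ->
  subsemigroup N -> fixator s `<=` N -> fixator t `<=` N ->
  N = [set: full_transf T].
Proof.
move=> st Nsub sN tN.
have [X stX] : exists X, ~ (s X <-> t X).
  apply/existsNP => E; apply: st; apply/seteqP.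
  by split=> X /E.
have [i _] := Tinf; have [h hI hs] := Aind [:: X] (~` s).
apply/seteqP; split=> // g _.
have [|f1 [f2 [f3 [f1P f2P f3P ->]]]] :=
  transf_three_factors (i 0) (B := ~` cell s [:: X]) g hI.
  by move=> x; apply/opposite_not_cell/hs/mem_head.
have Ns f : (forall x, ~ (~` cell s [:: X]) x -> f x = x) -> N f.
  move=> fP; apply: sN; exists [:: X] => x sx; apply: fP; exact.
apply: (Nsub); [apply: (Nsub)|]; [exact: (Ns _ f1P)| |exact: (Ns _ f3P)].
apply: tN; exists [:: X] => x tx; apply: f2P => sx; apply: stX.
by rewrite -(sx _ (mem_head _ _)) (tx _ (mem_head _ _)).
Qed.

End Fixators.

(** * Conjugacy *)

Section Conjugacy.
Variable T : Type.
Implicit Types M N : set (full_transf T).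

(** Conjugacy with the conjugating permutation and its inverse made explicit:
it determines [N] from [M], which bounds the size of a conjugacy class. *)
Definition conjugate_by (p : full_transf T * full_transf T) M N : Prop :=
  [/\ cancel p.1 p.2, cancel p.2 p.1 & N = [set (p.2 * m * p.1)%g | m in M]].

Lemma conjugate_refl M : conjugate M M.
Proof.
exists id, id; split=> //; apply/seteqP; split=> [m Mm|_ [m Mm <-]//].
by exists m.
Qed.

Lemma conjugate_sym M N : conjugate M N -> conjugate N M.
Proof.
move=> [a [b [ab ba ->]]]; exists b, a; split=> //.
have E (m : full_transf T) : (a * (b * m * a) * b)%g = m.
  by apply/funext => x; rewrite !transf_mulE !ab.
apply/seteqP; split=> [m Mm|_ [_ [m Mm <-] <-]]; last by rewrite E.
by exists (b * m * a)%g; [exists m|exact: E].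
Qed.

Lemma conjugate_trans M N P : conjugate M N -> conjugate N P -> conjugate M P.
Proof.
move=> [a [b [ab ba ->]]] [c [d [cd dc ->]]].
exists (a * c)%g, (d * b)%g.
split; [by move=> x; rewrite !transf_mulE cd ab|
        by move=> x; rewrite !transf_mulE ba dc|by rewrite image_comp].
Qed.

End Conjugacy.

Theorem mainTheorem12 (Omega : Type) (Omega_inf : infinite_set [set: Omega]) :
  exists F : set (set (full_transf Omega)),
    [/\ forall M, F M -> maximal_subsemigroup M,
        forall M N, F M -> F N -> M <> N -> ~ conjugate M N &
        F #= [set: set (set Omega)]].
Proof.
have natO : embeds nat Omega.
  move/infiniteP : Omega_inf => /card_leP/injfunPex[f _ fI].
  exists (fun n => set_val (f (SigSub (mem_setT n)))) => m n /val_inj E.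
  by have /(congr1 val) := fI _ _ (mem_setT _) (mem_setT _) E.
have [A Aind] := independent_family natO.
have /choice[M MP] : forall s, exists M,
    maximal_subsemigroup M /\ fixator A s `<=` M.
  by move=> s; have [M ? ?] := fixator_maximal natO Aind s; exists M.
have MI : injective M.
  move=> s t st; apply: contrapT => nst.
  have [[Msub MnT _] sM] := MP s; have [_ tM] := MP t.
  by apply: MnT; apply: (fixators_generate natO Aind nst) => //; rewrite st.
have natPO : embeds nat (set Omega) := embeds_trans natO (embeds_set1 Omega).
(* A map is determined by its graph, a subset of [Omega * Omega]. *)
have funPO : embeds (full_transf Omega) (set Omega).
  apply: embeds_trans (embeds_set (embeds_square natO)).
  exists (fun f => [set p | p.2 = f p.1]) => f g fg; apply/funext => x.
  by have : [set p | p.2 = g p.1] (x, f x) by rewrite -fg.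
have [p pI] : embeds (full_transf Omega * full_transf Omega) (set Omega).
  exact: embeds_trans (embeds_prod funPO funPO) (embeds_square natPO).
have [g gI gM] : exists2 g : set (set Omega) -> set (set Omega), injective g &
    forall s t, conjugate (M (g s)) (M (g t)) -> s = t.
  apply: (inequivalent_family (R := fun s t => conjugate (M s) (M t))
    (Q := fun c s t => exists2 ab, c = p ab & conjugate_by ab (M s) (M t))) => //.
  - exact: Cantor.
  - by move=> s; exact: conjugate_refl.
  - by move=> s t; exact: conjugate_sym.
  - by move=> s t u; exact: conjugate_trans.
  - by move=> s t [a [b abP]]; exists (p (a, b)), (a, b).
  - move=> c s t t' [ab -> [_ _ Mt]] [ab' /pI <- [_ _ Mt']].
    by apply: MI; rewrite Mt Mt'.
exists [set M (g s) | s in [set: set (set Omega)]]; split.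
- by move=> _ [s _ <-]; have [] := MP (g s).
- by move=> _ _ [s _ <-] [t _ <-] ne /gM st; apply: ne; rewrite st.
- by apply: inj_card_eq => s t _ _ /MI/gI.
Qed.
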